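(* For every finite graph $F$, we have \[\rho(\omega\cdot F)\geq\frac{|V(F)|}{2|V(F)|-\alpha(F)},\] where $\alpha(F)$ is the size of the largest independent set in $F$.
   Context: Finite graphs are assumed to have at least one vertex. For a finite graph $F$, $\omega\cdot F$ denotes the disjoint union of a countably infinite number of copies of $F$. Let $K_{\mathbb{N}}$ be the complete graph on the natural numbers $\mathbb{N}=\{1,2,\dots\}$, and $[n]=\{1,\dots,n\}$. For $S\subseteq\mathbb{N}$ the (upper) density is $\bar d(S)=\limsup_{n\to\infty}|S\cap[n]|/n$, and for a subgraph $H'\subseteq K_{\mathbb{N}}$ we set $\bar d(H')=\bar d(V(H'))$. For a countably infinite graph $H$ (vertex set of the same cardinality as $\mathbb{N}$), the Ramsey upper density $\rho(H)$ is the supremum of the values $\lambda$ for which, for every two-coloring of $E(K_{\mathbb{N}})$, there exists a monochromatic (not necessarily induced) subgraph $H'\subseteq K_{\mathbb{N}}$, isomorphic to $H$, with $\bar d(H')\geq\lambda$. *)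

(* Defs.v *)
From HB Require Import structures.
From mathcomp Require Import all_boot all_order all_algebra.
From mathcomp Require Import all_classical all_reals all_analysis.
Set Implicit Arguments.
Unset Strict Implicit.
Unset Printing Implicit Defensive.
Import Order.TTheory GRing.Theory Num.Theory.
Local Open Scope classical_set_scope.
Local Open Scope ring_scope.

Record sgraph (V : Type) := SGraph {
  adj :> rel V;
  adj_sym : symmetric adj;
  adj_irr : irreflexive adj
}.

(* A subgraph need not be induced. Irreflexivity of [sub_edge] follows from
   [sub_edgeP]. *)
Record subgraph (V : Type) (G : sgraph V) := Subgraph {
  sub_vert : set V;
  sub_edge : rel V;
  sub_edge_sym : symmetric sub_edge;
  sub_edgeP : forall x y, sub_edge x y ->
    [/\ G x y, sub_vert x & sub_vert y]
}.

Definition isomorphic_to (W V : Type) (G : sgraph V) (H' : subgraph G)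
    (H : sgraph W) : Prop :=
  exists f : W -> V,
    set_bij [set: W] (sub_vert H') f /\
    forall u v, sub_edge H' (f u) (f v) = H u v.

Section Complete.
Variable V : eqType.

Let neq_sym : symmetric (fun x y : V => x != y).
Proof. by move=> x y; rewrite eq_sym. Qed.

Let neq_irr : irreflexive (fun x y : V => x != y).
Proof. by move=> x; rewrite eqxx. Qed.

Definition complete_graph : sgraph V := SGraph neq_sym neq_irr.
End Complete.

Definition posnat := {n : nat | (0 < n)%N}.

Definition KN : sgraph posnat := complete_graph posnat.

Section OmegaCopies.
Variables (V : Type) (F : sgraph V).

Let copies_adj (p q : nat * V) := (p.1 == q.1) && F p.2 q.2.

Let copies_sym : symmetric copies_adj.
Proof. by move=> p q; rewrite /copies_adj eq_sym adj_sym. Qed.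

Let copies_irr : irreflexive copies_adj.
Proof. by move=> p; rewrite /copies_adj adj_irr andbF. Qed.

Definition omega_copies : sgraph (nat * V) := SGraph copies_sym copies_irr.
End OmegaCopies.

Definition independent (V : finType) (F : sgraph V) (A : {set V}) : bool :=
  [forall x in A, forall y in A, ~~ F x y].

Definition alpha (V : finType) (F : sgraph V) : nat :=
  \max_(A : {set V} | independent F A) #|A|.

(* The junk term 0 / 0 at n = 0 does not affect the limit superior. *)
Definition upper_density (R : realType) (S : set posnat) : \bar R :=
  limn_esup (fun n : nat =>
    ((count (mem [set val x | x in S]) (iota 1 n))%:R / n%:R : R)%:E).

(* A two-coloring of the edges of [KN] is a symmetric boolean function; its
   values on the diagonal are never used. *)
Definition monochromatic (c : posnat -> posnat -> bool) (H' : subgraph KN) :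
    Prop :=
  exists b : bool, forall x y, sub_edge H' x y -> c x y = b.

(* The supremum is taken in the extended reals, where it always exists. *)
Definition ramsey_upper_density (R : realType) (W : Type) (H : sgraph W) :
    \bar R :=
  ereal_sup [set lambda%:E | lambda in [set lambda : R |
    forall c : posnat -> posnat -> bool, symmetric c ->
      exists H' : subgraph KN,
        [/\ monochromatic c H', isomorphic_to H' H
          & (lambda%:E <= upper_density R (sub_vert H'))%E]]].

(* Main.v *)
Require Import Defs.
From mathcomp Require Import all_boot all_order all_algebra.
From mathcomp Require Import all_classical all_reals all_analysis.
From mathcomp Require Import zify lra.
Import Order.TTheory GRing.Theory Num.Theory.

(** In the finite setting, every 2-colouring of a complete graph on a finite set
    X contains disjoint copies of F, all of one colour, that cover at least
    |V| / (2|V| - alpha) of X up to an additive constant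
    ([monochromatic_packing]; this is the upper bound of Burr, Erdos and
    Spencer).  The key notion is a bowtie: a set of at most 2|V| - alpha points
    containing a copy of F in each of the two colours.  Removing a bowtie gains
    one copy whichever colour is eventually wanted, at the price of
    2|V| - alpha points, so one may assume that X has no bowtie.  But a large
    clique of colour b disjoint from a large clique of the other colour always
    creates a bowtie: thin both out until all edges between them have one
    colour, say b; the b-copy of F puts an independent set of size alpha in the
    other clique and the rest in its own, while the copy of colour not b lies
    in the other clique and reuses those alpha points ([bowtie_of_cliques]).
    Hence a bowtie-free set which is large enough for Ramsey's theorem to give
    a large b-clique A has no large clique of the other colour outside A.
    Ramsey's theorem then finds b-cliques again and again, and the rest of the
    set is tiled by copies of colour b with bounded waste
    ([one_colour_tiling]).

    The infinite statement follows by cutting the positive integers into the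
    blocks (k!, (k+1)!].  Each block contains a packing as above, of a colour
    depending on k; some colour b occurs for infinitely many k, and the union
    of the packings in those blocks is a b-coloured copy of omega.F
    ([subgraph_of_copies]).  As k!/(k+1)! tends to 0, the initial segment
    [1, (k+1)!] is almost entirely made of the k-th block, so the density of
    the union along these k tends to at least |V| / (2|V| - alpha). *)

(** * Ramsey theorems for lists *)

Section Colouring.
Local Set Implicit Arguments.
Local Unset Strict Implicit.
Local Unset Printing Implicit Defensive.
Variables (T : eqType) (c : rel T).
Hypothesis c_sym : symmetric c.

Definition clique (b : bool) (A : seq T) := pairwise (fun x y => c x y == b) A.

Lemma clique_edge b A x y :
  clique b A -> x \in A -> y \in A -> x != y -> c x y = b.
Proof.
elim: A => //= a A IH /andP[/allP aA cA]; rewrite !inE.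
case/predU1P=> [->|xA] /predU1P[->|yA]; rewrite ?eqxx //.
- by move=> _; apply/eqP/aA.
- by move=> _; rewrite c_sym; apply/eqP/aA.
- exact: IH.
Qed.

Lemma size_filter_split (p : pred T) (X : seq T) :
  size [seq x <- X | p x == true] + size [seq x <- X | p x == false] = size X.
Proof.
rewrite !size_filter -(count_predC (fun x => p x == true)); congr (_ + _).
by apply: eq_count => x /=; case: (p x).
Qed.

(** The classical recursion on the two target sizes: the neighbours of the first
    point in one of the two colours make up half of the others.  Subsequences
    rather than subsets are produced because [clique] and [uniq] pass to
    them. *)
Lemma ramsey a1 a2 (X : seq T) : 2 ^ (a1 + a2) <= size X ->
  exists b A, [/\ subseq A X, size A = (if b then a1 else a2) & clique b A].
Proof.
have [m] := ubnP (a1 + a2); elim: m => // m IH in a1 a2 X *.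
case: a1 => [|a1]; first by exists true, [::]; rewrite sub0seq.
case: a2 => [|a2]; first by exists false, [::]; rewrite sub0seq.
case: X => [|x X] lt_m; first by rewrite leqn0 expn_eq0.
rewrite addSn expnS => leX.
have extend b A : subseq A [seq y <- X | c x y == b] -> clique b A ->
    subseq (x :: A) (x :: X) /\ clique b (x :: A).
  move=> sA cA; split; first by rewrite /= eqxx (subseq_trans sA) ?filter_subseq.
  rewrite /clique /= (cA : pairwise _ A) andbT; apply/allP => y /(mem_subseq sA).
  by rewrite mem_filter => /andP[].
have subX b A : subseq A [seq y <- X | c x y == b] -> subseq A (x :: X).
  by move=> sA; rewrite (subseq_trans sA) ?(subseq_trans (filter_subseq _ _)) ?subseq_cons.
have sizeX := size_filter_split (c x) X.
have [le1|lt1] := leqP (2 ^ (a1 + a2.+1)) (size [seq y <- X | c x y == true]).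
  have [|b [A [sA zA cA]]] := IH a1 a2.+1 _ _ le1; first by lia.
  case: b zA cA => zA cA; last by exists false, A; rewrite (subX true).
  by have [sA' cA'] := extend _ _ sA cA; exists true, (x :: A); rewrite /= zA.
have le2 : 2 ^ (a1.+1 + a2) <= size [seq y <- X | c x y == false].
  rewrite addSnnS; move: leX => /=; lia.
have [|b [A [sA zA cA]]] := IH a1.+1 a2 _ _ le2; first by lia.
case: b zA cA => zA cA; first by exists true, A; rewrite (subX false).
by have [sA' cA'] := extend _ _ sA cA; exists false, (x :: A); rewrite /= zA.
Qed.

(** Each point of A in turn keeps only the majority colour class of what is left
    of B, which at worst halves it. *)
Lemma homogeneous_side k (A B : seq T) : 2 ^ size A * k <= size B ->
  exists B', [/\ subseq B' B, k <= size B' &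
    {in A & B' &, forall a y y', c a y = c a y'}].
Proof.
elim: A B => [|a A IH] B; first by rewrite mul1n; exists B.
rewrite /= expnS => leB.
have [b leb] : exists b, 2 ^ size A * k <= size [seq y <- B | c a y == b].
  have sizeB := size_filter_split (c a) B.
  have [|] := leqP (2 ^ size A * k) (size [seq y <- B | c a y == true]).
    by exists true.
  by exists false; nia.
have [B' [sB' leB' hB']] := IH _ leb.
exists B'; split=> //; first exact: subseq_trans sB' (filter_subseq _ _).
move=> x y y'; rewrite inE => /predU1P[->|xA]; last exact: hB'.
by move=> /(mem_subseq sB') + /(mem_subseq sB'); rewrite !mem_filter
  => /andP[/eqP-> _] /andP[/eqP-> _].
Qed.

(** By [homogeneous_side] the edges from a point of A to B' all have the same
    colour, and the majority of these colours over t + t points of A occurs at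
    least t times.  Only t + t points of A are used, so that A and B may have
    the same size. *)
Lemma bipartite_ramsey t (A B : seq T) :
    0 < t -> t + t <= size A -> 2 ^ (t + t) * t <= size B ->
  exists b A' B', [/\ subseq A' A, subseq B' B, t <= size A', t <= size B' &
    {in A' & B', forall x y, c x y = b}].
Proof.
move=> t_gt0 leA leB; pose A0 := take (t + t) A.
have sA0 : size A0 = t + t by rewrite size_takel.
have [|B' [sB' leB' hB']] := @homogeneous_side t A0 B; first by rewrite sA0.
case: B' => [|y0 B'] in sB' leB' hB' *; first by rewrite leqNgt t_gt0 in leB'.
have [b leb] : exists b, t <= size [seq x <- A0 | c x y0 == b].
  have := size_filter_split (c^~ y0) A0; rewrite sA0.
  have [|] := leqP t (size [seq x <- A0 | c x y0 == true]); first by exists true.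
  by exists false; lia.
exists b, [seq x <- A0 | c x y0 == b], (y0 :: B'); split=> //.
  exact: subseq_trans (filter_subseq _ _) (take_subseq _ _).
move=> x y; rewrite mem_filter => /andP[/eqP<- xA0] yB'.
by apply: hB' => //; rewrite mem_head.
Qed.

(** * Bowties *)

Variables (V : finType) (F : sgraph V).
Hypothesis V_gt0 : 0 < #|V|.
Implicit Types (f : {ffun V -> T}) (fs : seq {ffun V -> T}) (X Y : seq T).

Definition is_copy b (f : V -> T) :=
  injective f /\ forall u v, F u v -> c (f u) (f v) = b.

Definition supp fs : seq T := flatten [seq codom f | f : {ffun V -> T} <- fs].

(** Uniqueness of the concatenated supports says at once that the copies are
    pairwise disjoint and that none is repeated. *)
Definition packing b X fs :=
  [/\ forall f, f \in fs -> is_copy b f, uniq (supp fs)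
    & {subset supp fs <= X}].

Definition bowtie_size := 2 * #|V| - alpha F.

Definition bowtie (W : seq T) := size W <= bowtie_size /\
  forall b, exists2 f : {ffun V -> T}, is_copy b f & {subset codom f <= W}.

Lemma alphaP : exists2 I : {set V}, independent F I & #|I| = alpha F.
Proof.
have ind0 : independent F finset.set0.
  by apply/'forall_implyP => x; rewrite finset.in_set0.
have : 0 < #|independent F| by apply/card_gt0P; exists finset.set0.
case/(eq_bigmax_cond (fun A : {set V} => #|A|)) => I indI eqI.
by exists I => //; rewrite /alpha eqI.
Qed.

Lemma alpha_le : alpha F <= #|V|.
Proof. by have [I _ <-] := alphaP; exact: max_card. Qed.

Lemma copy_codom_uniq f b : is_copy b f -> uniq (codom f).
Proof. by case=> fI _; apply/injectiveP. Qed.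

Lemma clique_embedding b (A : seq T) : uniq A -> #|V| <= size A -> clique b A ->
  exists p : V -> T, [/\ injective p, forall v, p v \in A
    & forall u v, u != v -> c (p u) (p v) = b].
Proof.
case: A => [|x0 A'] ; first by rewrite leqNgt V_gt0.
set A := x0 :: A' => uA leA cA.
have ltA (v : V) : enum_rank v < size A by apply: leq_trans leA.
pose p (v : V) := nth x0 A (enum_rank v).
have pI : injective p.
  by move=> u v /eqP; rewrite nth_uniq // => /eqP/ord_inj/enum_rank_inj.
have pA v : p v \in A by rewrite mem_nth.
exists p; split=> // u v uv.
by apply: (clique_edge cA (pA u) (pA v)); rewrite (inj_eq pI).
Qed.

(** Let p and q enumerate a b-clique and a clique of the other colour, with all
    edges between them of colour b.  The copy q of F has colour not b; moving
    every vertex outside a maximum independent set I from q to p gives a copy of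
    colour b, since no edge of F has both ends in I.  The two copies share the
    points q v with v in I, hence together use 2|V| - alpha points. *)
Lemma bowtie_of_embeddings b (p q : V -> T) :
    injective p -> injective q -> (forall u v, p u != q v) ->
    (forall u v, u != v -> c (p u) (p v) = b) ->
    (forall u v, u != v -> c (q u) (q v) = ~~ b) ->
    (forall u v, c (p u) (q v) = b) ->
  exists2 W, bowtie W & forall x, x \in W -> exists v, x = p v \/ x = q v.
Proof.
move=> pI qI pq cp cq cpq; have [I indI cardI] := alphaP.
pose W := codom q ++ [seq p v | v <- enum (~: I)%SET].
have neqF u v : F u v -> u != v by apply: contraTneq => ->; rewrite adj_irr.
exists W; last first.
  move=> x; rewrite mem_cat => /orP[/codomP[v ->]|/mapP[v _ ->]].
    by exists v; right.
  by exists v; left.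
split.
  rewrite size_cat size_codom size_map -cardE cardsCs finset.setCK cardI.
  by rewrite /bowtie_size; have := alpha_le; lia.
pose h := [ffun v => if v \in I then q v else p v].
have copyq : is_copy (~~ b) (finfun q).
  split; first by move=> u v; rewrite !ffunE; exact: qI.
  by move=> u v /neqF; rewrite !ffunE; exact: cq.
have copyh : is_copy b h.
  split=> u v; rewrite !ffunE.
    case: ifP => _; case: ifP => _ e; [exact: qI|by have := pq v u; rewrite e eqxx| |exact: pI].
    by have := pq u v; rewrite e eqxx.
  move=> Fuv; case: ifP => uI; case: ifP => vI; last by apply: cp; exact: neqF.
  - have /'forall_implyP/(_ u uI)/'forall_implyP/(_ v vI) := indI.
    by rewrite Fuv.
  - by rewrite c_sym.
  - by [].
move=> b'; have [->|] := eqVneq b' b.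
  exists h => // x /codomP[v ->]; rewrite ffunE mem_cat.
  case: ifP => vI; first by rewrite codom_f.
  by rewrite orbC map_f // mem_enum finset.in_setC vI.
move=> bb'; rewrite (_ : b' = ~~ b); last by move: bb'; case: (b); case: (b').
exists (finfun q) => // x /codomP[v ->]; rewrite ffunE mem_cat.
by rewrite codom_f.
Qed.

(** The size at which [bipartite_ramsey] leaves |V| points on either side. *)
Definition clique_bound := 2 ^ (#|V| + #|V|) * #|V|.

(** Whatever the colour found by [bipartite_ramsey] between the two cliques, it
    is the colour of one of them, and [bowtie_of_embeddings] applies with that
    clique in the role of p. *)
Lemma bowtie_of_cliques b (A B : seq T) :
    uniq A -> uniq B -> {in A, forall x, x \notin B} ->
    clique b A -> clique (~~ b) B -> size A = clique_bound -> size B = clique_bound ->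
  exists2 W, bowtie W & {subset W <= A ++ B}.
Proof.
move=> uA uB dAB cA cB zA zB.
have le2 : #|V| + #|V| <= clique_bound.
  rewrite /clique_bound addnn -mul2n leq_pmul2r //.
  by rewrite (leq_trans (_ : 2 <= 2 ^ 1)) // leq_exp2l // mul2n double_gt0.
have [|||b' [A' [B' [sA sB zA' zB' cAB]]]] := @bipartite_ramsey #|V| A B.
- by [].
- by rewrite zA.
- by rewrite zB.
have cA' := subseq_pairwise sA cA; have cB' := subseq_pairwise sB cB.
have [p [pI pA cp]] := clique_embedding (subseq_uniq sA uA) zA' cA'.
have [q [qI qB cq]] := clique_embedding (subseq_uniq sB uB) zB' cB'.
have pq u v : p u != q v.
  apply: contraTneq (dAB _ (mem_subseq sA (pA u))) => ->.
  by rewrite negbK (mem_subseq sB).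
have inAB v : p v \in A ++ B /\ q v \in A ++ B.
  by rewrite !mem_cat (mem_subseq sA (pA v)) (mem_subseq sB (qB v)) orbT.
case: (eqVneq b' b) => bb'.
  have [|W bW sW] := bowtie_of_embeddings pI qI pq cp cq.
    by move=> u v; rewrite cAB.
  by exists W => // x /sW[v [] ->]; have [] := inAB v.
have [|| |W bW sW] := @bowtie_of_embeddings (~~ b) q p qI pI _ cq.
- by move=> u v; rewrite eq_sym.
- by rewrite negbK.
- by move=> u v; rewrite c_sym cAB //; move: bb'; case: (b); case: (b').
by exists W => // x /sW[v [] ->]; have [] := inAB v.
Qed.

(** * Packing a finite set with copies of one colour *)

Lemma size_remove (W Y : seq T) : uniq Y ->
  size Y <= size [seq y <- Y | y \notin W] + size W.
Proof.
move=> uY; rewrite size_filter -[leqLHS](count_predC (mem W)) addnC leq_add2l.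
rewrite -size_filter uniq_leq_size ?filter_uniq // => y.
by rewrite mem_filter => /andP[].
Qed.

Lemma size_remove_lt (W Y : seq T) x : x \in W -> x \in Y ->
  size [seq y <- Y | y \notin W] < size Y.
Proof.
move=> xW xY; rewrite size_filter -[ltnRHS](count_predC (mem W)).
rewrite -[ltnLHS]add0n ltn_add2r -has_count.
by apply/hasP; exists x.
Qed.

(** The set W is discarded as a whole even when f fills only part of it: for a
    bowtie, the rest of W belongs to the copy of the other colour. *)
Lemma packing_cons b (W Y : seq T) f fs :
    is_copy b f -> {subset codom f <= W} -> {subset codom f <= Y} ->
    packing b [seq y <- Y | y \notin W] fs -> packing b Y (f :: fs).
Proof.
move=> cf fW fY [cfs ufs sfs]; split.
- by move=> g; rewrite inE => /predU1P[->//|/cfs].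
- rewrite /supp /= cat_uniq ufs andbT (copy_codom_uniq cf) /=.
  apply/hasPn => x /sfs; rewrite mem_filter => /andP[xW _].
  by apply: contra xW; exact: fW.
- move=> x; rewrite mem_cat => /orP[/fY//|/sfs].
  by rewrite mem_filter => /andP[].
Qed.

(** As long as Z exceeds the Ramsey bound it contains a large clique, necessarily
    of colour b; one copy of F is cut out of that clique, and the hypothesis on
    Z is inherited by what remains. *)
Lemma one_colour_tiling b Z : uniq Z ->
    (forall A, uniq A -> {subset A <= Z} -> size A = clique_bound -> ~ clique (~~ b) A) ->
  exists2 fs, packing b Z fs & size Z <= #|V| * size fs + 2 ^ (clique_bound + clique_bound).
Proof.
have [m] := ubnP (size Z); elim: m => // m IH in Z * => ltZ uZ noZ.
have [small|large] := leqP (size Z) (2 ^ (clique_bound + clique_bound)).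
  by exists [::]; rewrite ?muln0.
have [b' [A [sA zA cA]]] := ramsey (ltnW large).
rewrite if_same in zA.
have uA := subseq_uniq sA uZ; have AZ := mem_subseq sA.
have ? : b' = b.
  apply/eqP; apply: contra_notT (noZ A uA AZ zA) => bb'.
  by rewrite (_ : ~~ b = b') //; move: bb'; case: (b); case: (b').
subst b'.
have [|p [pI pA cp]] := clique_embedding uA _ cA.
  by rewrite zA /clique_bound leq_pmull // expn_gt0.
have copyp : is_copy b (finfun p).
  split; first by move=> u v; rewrite !ffunE; exact: pI.
  move=> u v Fuv; rewrite !ffunE; apply: cp.
  by apply: contraTneq Fuv => ->; rewrite adj_irr.
set W := codom (finfun p).
have WZ : {subset W <= Z} by move=> x /codomP[v ->]; rewrite ffunE AZ.
have /card_gt0P[v0 _] := V_gt0.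
have xW : finfun p v0 \in W by rewrite codom_f.
have lt' := size_remove_lt xW (WZ _ xW).
have [||B uB BZ|fs pfs lefs] := IH [seq y <- Z | y \notin W].
- exact: leq_trans lt' _.
- exact: filter_uniq.
- by apply: noZ => // x /BZ; rewrite mem_filter => /andP[].
exists (finfun p :: fs); first exact: (packing_cons copyp _ _ pfs).
rewrite (leq_trans (size_remove W uZ)) // size_codom /= mulnS.
by rewrite addnC -addnA leq_add2l.
Qed.

(** The colour is not known before the bowties are exhausted, so a bowtie is
    removed first and the copy of the colour given by the induction hypothesis
    is taken from it afterwards.  In the bowtie-free case the clique A is simply
    wasted: its size is part of the additive constant. *)
Lemma monochromatic_packing X : uniq X -> exists b fs, packing b X fs /\
  size X <= bowtie_size * size fs + (2 ^ (clique_bound + clique_bound) + clique_bound).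
Proof.
have [m] := ubnP (size X); elim: m => // m IH in X * => ltX uX.
have [[W [[zW copyW] WX]]|nobow] := pselect (exists W, bowtie W /\ {subset W <= X}).
  have /card_gt0P[v0 _] := V_gt0.
  have xW : exists x, x \in W.
    by have [f _ fW] := copyW true; exists (f v0); rewrite fW // codom_f.
  have [x {}xW] := xW.
  have lt' := size_remove_lt xW (WX _ xW).
  have [||b [fs [pfs lefs]]] := IH [seq y <- X | y \notin W].
  - exact: leq_trans lt' _.
  - exact: filter_uniq.
  have [f cf fW] := copyW b.
  exists b, (f :: fs); split.
    by apply: (packing_cons cf fW _ pfs) => y /fW/WX.
  rewrite (leq_trans (size_remove W uX)) //= mulnS.
  by rewrite addnC -addnA leq_add.
have [small|large] := leqP (size X) (2 ^ (clique_bound + clique_bound)).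
  by exists true, [::]; split; rewrite // muln0 (leq_trans small) ?leq_addr.
have [b [A [sA zA cA]]] := ramsey (ltnW large).
rewrite if_same in zA.
have uA := subseq_uniq sA uX; have AX := mem_subseq sA.
have [||fs [cfs ufs sfs] lefs] := @one_colour_tiling b [seq y <- X | y \notin A].
- exact: filter_uniq.
- move=> B uB BX zB cB; apply: nobow.
  have [x xA|W bW WAB] := bowtie_of_cliques uA uB _ cA cB zA zB.
    by apply/negP => /BX; rewrite mem_filter xA.
  exists W; split=> // x /WAB; rewrite mem_cat => /orP[/AX//|/BX].
  by rewrite mem_filter => /andP[].
exists b, fs; split.
  by split=> // x /sfs; rewrite mem_filter => /andP[].
rewrite (leq_trans (size_remove A uX)) // zA addnA leq_add2r (leq_trans lefs) //.
rewrite leq_add2r leq_mul2r; apply/orP; right.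
by rewrite /bowtie_size; have := alpha_le; lia.
Qed.

End Colouring.

(** * From finite packings to infinitely many copies *)

Lemma limn_esup_ge_often (R : realType) (u : nat -> \bar R) (l : \bar R) :
    (forall n, exists2 m, n <= m & (l <= u m)%E) ->
  (l <= limn_esup u)%E.
Proof.
move=> often; rewrite /limn_esup limf_esupE; apply: le_ereal_inf_tmp => _ [V [N _ NV] <-].
have [m Nm lm] := often N; apply: le_ereal_sup_tmp.
by exists (u m) => //; exists m => //; exact: NV.
Qed.

Section Assembly.
Local Set Implicit Arguments.
Local Unset Strict Implicit.
Variables (V : finType) (F : sgraph V).
Hypothesis V_gt0 : 0 < #|V|.
Variable c : rel posnat.
Hypothesis c_sym : symmetric c.

(** An infinite set of finite functions into a countable type is in bijection
    with nat; numbering the copies by such a bijection r, with inverse h,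
    identifies their disjoint union with omega.F. *)
Lemma subgraph_of_copies b (S : set {ffun V -> posnat}) :
    infinite_set S -> (forall f, S f -> is_copy c F b f) ->
    (forall f g u v, S f -> S g -> f u = g v -> f = g) ->
  exists H' : subgraph KN,
    [/\ monochromatic c H', isomorphic_to H' (omega_copies F)
      & forall f v, S f -> sub_vert H' (f v)].
Proof.
move=> infS copyS disjS.
have /card_set_bijP[r [_ rI rS]] := eq_card_nat (countableP S) infS.
have /choice[h hP] i : exists f, S f /\ r f = i by have [f] := rS i I; exists f.
have hK f : S f -> h (r f) = f.
  by move=> Sf; have [? ?] := hP (r f); apply: rI; rewrite ?inE.
pose g (p : nat * V) := h p.1 p.2.
have gI : injective g.
  move=> [i u] [j v]; rewrite /g /= => e.
  have [Si ri] := hP i; have [Sj rj] := hP j.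
  have eij := disjS _ _ _ _ Si Sj e.
  have ij : i = j by rewrite -ri -rj eij.
  by subst j; congr (_, _); exact: (copyS _ Si).1 e.
pose e (x y : posnat) :=
  `[< exists p q, [/\ g p = x, g q = y & omega_copies F p q] >].
have e_sym : symmetric e.
  by move=> x y; apply/asboolP/asboolP => -[p [q [px qy pq]]];
    exists q, p; rewrite adj_sym.
have eP x y : e x y -> [/\ KN x y, range g x & range g y].
  move=> /asboolP[p [q [<- <- pq]]]; split; [|by exists p|by exists q].
  by apply: contraTneq pq => /gI ->; rewrite adj_irr.
exists (Subgraph e_sym eP); split=> /=.
- exists b => x y /asboolP[[i u] [[j v] [<- <-]]] /andP[/= /eqP<- Fuv].
  by have [Si _] := hP i; exact: (copyS _ Si).2.
- exists g; split.
    split=> [p _|p q _ _ /gI //|x [p _ <-]]; first by exists p.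
    by exists p.
  move=> p q; apply/asboolP/idP => [[p' [q' [/gI<- /gI<-]]] //|pq].
  by exists p, q.
- by move=> f v Sf; exists (r f, v); rewrite // /g /= hK.
Qed.

(** The block of the integers n with k! < n <= (k+1)!. *)
Definition block k : seq posnat :=
  [seq exist (fun n => is_true (0 < n)) i.+1 isT | i <- iota k`! (k * k`!)].

Lemma factS_split k : k.+1`! = k`! + k * k`!. Proof. by rewrite factS mulSn. Qed.

Lemma mem_block k x : (x \in block k) = (k`! < val x <= k.+1`!).
Proof.
case: x => [[|i] i0] //=; rewrite factS_split.
apply/mapP/idP => [[j]|ki].
  by rewrite mem_iota => /andP[lo hi] [->]; rewrite ltnS lo.
by exists i; [rewrite mem_iota|exact: val_inj].
Qed.

Lemma block_uniq k : uniq (block k).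
Proof. by rewrite map_inj_uniq ?iota_uniq // => i j []. Qed.

Lemma size_block k : size (block k) = k * k`!.
Proof. by rewrite size_map size_iota. Qed.

Lemma block_inj k l x : x \in block k -> x \in block l -> k = l.
Proof.
rewrite !mem_block => /andP[k1 k2] /andP[l1 l2].
have [kl|lk|//] := ltngtP k l.
  by have := leq_trans l1 k2; rewrite ltnNge (leq_fact kl).
by have := leq_trans k1 l2; rewrite ltnNge (leq_fact lk).
Qed.

Lemma supp_mem (fs : seq {ffun V -> posnat}) f v : f \in fs -> f v \in supp fs.
Proof. by move=> ffs; apply/flatten_mapP; exists f; rewrite ?codom_f. Qed.

Lemma packing_disjoint b X (fs : seq {ffun V -> posnat}) f g u v :
  packing c F b X fs -> f \in fs -> g \in fs -> f u = g v -> f = g.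
Proof.
case=> _ + _; elim: fs => //= h fs IH; rewrite /supp /= cat_uniq.
case/and3P=> _ /hasPn dis ufs.
have no_clash f1 u1 v1 : f1 \in fs -> h u1 <> f1 v1.
  by move=> /(supp_mem v1)/dis + e; rewrite -e codom_f.
rewrite !inE => /predU1P[->|ffs] /predU1P[->|gfs] //.
- by move=> /no_clash; case.
- by move=> /esym/no_clash; case.
- exact: IH.
Qed.

Lemma size_supp (fs : seq {ffun V -> posnat}) : size (supp fs) = #|V| * size fs.
Proof. by elim: fs => [|f fs IH]; rewrite ?muln0 // size_cat IH size_codom mulnS. Qed.

Lemma supp_count (S : set posnat) (fs : seq {ffun V -> posnat}) k :
    uniq (supp fs) -> {subset supp fs <= block k} ->
    (forall x, x \in supp fs -> S x) ->
  #|V| * size fs <= count (mem [set val x | x in S]%classic) (iota 1 k.+1`!).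
Proof.
move=> ufs sfs Sfs; rewrite -size_supp -(size_map val) -size_filter.
apply: uniq_leq_size; first by rewrite map_inj_uniq //; exact: val_inj.
move=> _ /mapP[x xfs ->]; rewrite mem_filter; apply/andP; split.
  by rewrite inE; exists x => //; exact: Sfs.
have := sfs _ xfs; rewrite mem_block mem_iota => /andP[lo hi].
by rewrite add1n ltnS hi (leq_ltn_trans _ lo).
Qed.

(** One copy of omega.F serves infinitely many initial segments [1, (k+1)!] at
    once: those whose last block received the colour of that copy. *)
Lemma dense_monochromatic_copies : exists C (H' : subgraph KN),
  [/\ monochromatic c H', isomorphic_to H' (omega_copies F)
    & forall n, exists k s, [/\ n <= k, k * k`! <= bowtie_size F * s + C
      & #|V| * s <= count (mem [set val x | x in sub_vert H']%classic)
                      (iota 1 k.+1`!)]].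
Proof.
pose C := 2 ^ (clique_bound V + clique_bound V) + clique_bound V.
have /choice[P PP] k : exists bfs, packing c F bfs.1 (block k) bfs.2 /\
    k * k`! <= bowtie_size F * size bfs.2 + C.
  have [b [fs]] := monochromatic_packing c_sym F V_gt0 (block_uniq k).
  by rewrite size_block; exists (b, fs).
(* If colour true does not recur beyond n, every later colour is false. *)
have [b often] : exists b, forall n, exists2 k, n <= k & (P k).1 = b.
  have [often|/existsNP[n never]] := pselect (forall n, exists2 k, n <= k & (P k).1 = true).
    by exists true.
  exists false => m; exists (maxn n m); first exact: leq_maxr.
  by apply/negbTE/negP => eP; apply: never; exists (maxn n m); rewrite ?leq_maxl.
pose S := [set f | exists2 k, (P k).1 = b & f \in (P k).2]%classic.
have copyS f : S f -> is_copy c F b f.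
  by case=> k <- fk; have [[copyk _ _] _] := PP k; exact: copyk.
have inblock k f v : f \in (P k).2 -> f v \in block k.
  by move=> /(supp_mem v); have [[_ _ sk] _] := PP k; exact: sk.
have disjS f g u v : S f -> S g -> f u = g v -> f = g.
  move=> [k _ fk] [l _ gl] e.
  have kl : k = l.
    by apply: (@block_inj _ _ (f u)); [exact: inblock|rewrite e inblock].
  by subst l; have [pk _] := PP k; exact: packing_disjoint pk fk gl e.
have infS : infinite_set S.
  (* A finite list of copies has bounded values, whereas a late block of
     colour b contains a copy, and all its values exceed k. *)
  move=> /finite_seqP[s Ss]; have /card_gt0P[v0 _] := V_gt0.
  have [k lek bk] := often (maxn C.+1 (\max_(f <- s) val (f v0))).
  have [_ sizek] := PP k.
  have : 0 < size (P k).2.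
    rewrite lt0n; apply/eqP => s0; move: sizek; rewrite s0 muln0 add0n leqNgt.
    rewrite (leq_trans (leq_trans (leq_maxl _ _) lek)) //.
    by rewrite leq_pmulr ?fact_gt0.
  case Pk : (P k).2 => [//|f fs] _.
  have fk : f \in (P k).2 by rewrite Pk mem_head.
  have Sf : S f by exists k.
  have f_s : f \in s by rewrite Ss in Sf.
  have := inblock k f v0 fk; rewrite mem_block => /andP[+ _].
  rewrite ltnNge (leq_trans _ (fact_geq k)) // (leq_trans _ lek) // leq_max.
  apply/orP; right.
  exact: (leq_bigmax_seq f f_s).
have [H' [mono iso vertH]] := subgraph_of_copies infS copyS disjS.
exists C, H'; split=> // n; have [k nk bk] := often n.
have [[_ uk sk] lek] := PP k.
exists k, (size (P k).2); split=> //; apply: supp_count uk sk _.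
move=> x /flatten_mapP[f fk /codomP[v ->]]; apply: vertH.
by exists k.
Qed.
End Assembly.

(** * The lower bound on the Ramsey upper density *)

Local Open Scope ring_scope.

Theorem theorem9 (R : realType) (V : finType) (F : sgraph V)
    (V_nonempty : (0 < #|V|)%N) :
  ((#|V|%:R / (2 * #|V|%:R - (alpha F)%:R) : R)%:E
     <= ramsey_upper_density R (omega_copies F))%E.
Proof.
have DE : 2 * #|V|%:R - (alpha F)%:R = (bowtie_size F)%:R :> R.
  rewrite natrB ?natrM //; have := alpha_le F; lia.
have D_gt0 : 0 < (bowtie_size F)%:R :> R.
  by rewrite ltr0n /bowtie_size; have := alpha_le F; lia.
rewrite DE; set v : R := _ / _.
have v_ge0 : 0 <= v by rewrite divr_ge0 // ler0n.
have vD : v * (bowtie_size F)%:R = #|V|%:R by rewrite divfK ?gt_eqF.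
apply: ereal_sup_ubound; exists v => // c c_sym.
have [C [H' [mono iso dens]]] := dense_monochromatic_copies F V_nonempty c_sym.
exists H'; split=> //; apply/lee_subgt0Pr => e e_gt0.
apply: limn_esup_ge_often => n.
(* With N = (k+1)! the packing covers at least v (N - k! - C) points of [1, N],
   and k! + C <= (1 + C) k! = (1 + C) N / (k+1); K makes the loss
   v (1 + C) / (k+1) at most e. *)
pose K := Num.trunc (v * (1 + C%:R) / e).
have [k [s [maxk lek count_ge]]] := dens (maxn n K).
have [nk Kk] : (n <= k)%N /\ (K <= k)%N by move: maxk; rewrite geq_max => /andP.
have k_large : v * (1 + C%:R) <= e * k.+1%:R.
  rewrite [leRHS]mulrC -ler_pdivrMr //; apply: ltW.
  by apply: lt_le_trans (truncnS_gt _) _; rewrite ler_nat ltnS.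
exists k.+1`!; first exact: leq_trans nk (leq_trans (leqnSn _) (fact_geq _)).
rewrite -EFinB lee_fin ler_pdivlMr ?ltr0n ?fact_gt0 //.
apply: le_trans (_ : (#|V| * s)%:R <= _); last by rewrite ler_nat.
have q_ge1 : 1 <= k`!%:R :> R by rewrite ler1n fact_gt0.
have C_ge0 : 0 <= C%:R :> R by [].
have lekR : k%:R * k`!%:R <= (bowtie_size F)%:R * s%:R + C%:R :> R.
  by rewrite -!natrM -natrD ler_nat.
rewrite factS !natrM -vD -natr1.
have kl : v * (1 + C%:R) <= e * (k%:R + 1) by rewrite natr1.
move: lekR kl; set q := k`!%:R; set D := (bowtie_size F)%:R.
set s' := s%:R; set k' := k%:R; set C' := C%:R => lekR kl.
have h1 : v * (k' * q) <= v * (D * s' + C') by exact: ler_wpM2l.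
have h2 : v * (1 + C') * q <= e * (k' + 1) * q by apply: ler_wpM2r => //; lra.
have h3 : v * C' <= v * C' * q by rewrite ler_peMr ?mulr_ge0.
lra.
Qed.
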